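(* Let $M\in\mathbb N$. Let $\mathcal C_3'=\{q\in\mathcal V:(\mathbf V_q,\sigma)\text{ has the specification property}\}$ and $\mathcal C_4'=\{q\in\mathcal V:(\mathbf V_q,\sigma)\text{ is synchronised}\}$. Then $\dim_{\mathrm H}(\mathcal C_3')=1$. Moreover, $\dim_{\mathrm H}(\mathcal C_4')=1$.
   Context: $\Sigma_M=\{0,\dots,M\}^{\mathbb N}$ with the product topology; $\sigma$ is the one-sided shift; $\preccurlyeq$ is the lexicographic order; the reflection of a sequence replaces each symbol $x_i$ by $M-x_i$ and is denoted by an overline. $\dim_{\mathrm H}$ is Hausdorff dimension of subsets of $\mathbb R$. For $q\in(1,M+1]$, $\alpha(q)\in\Sigma_M$ is the quasi-greedy expansion of $1$ in base $q$: the lexicographically largest $(a_i)\in\Sigma_M$ with infinitely many non-zero terms and $\sum_i a_iq^{-i}=1$. $\mathcal V=\{q\in(1,M+1]:\overline{\alpha(q)}\preccurlyeq\sigma^n(\alpha(q))\preccurlyeq\alpha(q)\ \forall n\ge0\}$ and $\mathbf V_q=\{\mathbf x\in\Sigma_M:\overline{\alpha(q)}\preccurlyeq\sigma^n(\mathbf x)\preccurlyeq\alpha(q)\ \forall n\ge0\}$. For a subshift $X$, $\mathcal L(X)$ is its language (all finite factors of elements of $X$) and $B_S(X)$ the set of words of length $S$ in it. $X$ is transitive if for all $\upsilon,\nu\in\mathcal L(X)$ there is $\omega\in\mathcal L(X)$ with $\upsilon\omega\nu\in\mathcal L(X)$. $X$ has the specification property if there is $S\in\mathbb N$ such that for all $\upsilon,\nu\in\mathcal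 L(X)$ there is $\omega\in B_S(X)$ with $\upsilon\omega\nu\in\mathcal L(X)$. A transitive $X$ is synchronised if there is $\omega\in\mathcal L(X)$ such that $\upsilon\omega\in\mathcal L(X)$ and $\omega\nu\in\mathcal L(X)$ imply $\upsilon\omega\nu\in\mathcal L(X)$. *)

(* Defs.v *)
From HB Require Import structures.
From mathcomp Require Import all_boot all_order all_algebra.
From mathcomp Require Import all_classical all_reals all_analysis.

Set Implicit Arguments.
Unset Strict Implicit.
Unset Printing Implicit Defensive.

Import Order.TTheory GRing.Theory Num.Theory.
Import numFieldNormedType.Exports.

Local Open Scope classical_set_scope.
Local Open Scope ring_scope.

(* The index set of sequences is {1, 2, ...} on paper and [nat] here, so the
   [i]-th digit on paper is [x i.-1].  [big_lexi_order] makes [(x <= y)%O] the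
   lexicographic order. *)
Notation Sigma M := (big_lexi_order (fun _ : nat => 'I_M.+1)).

Section Sequences.
Variable M : nat.
Implicit Types (x y : Sigma M) (X : set (Sigma M)) (u v w : seq 'I_M.+1).

Definition sigma x : Sigma M := fun i => x i.+1.

(* [rev_ord d] has value [M - d]. *)
Definition reflection x : Sigma M := fun i => rev_ord (x i).

Definition language X : set (seq 'I_M.+1) :=
  [set u | exists2 x, X x & exists n, u = mkseq (fun i => x (n + i)%N) (size u)].

Definition words_of_length X (S : nat) : set (seq 'I_M.+1) :=
  [set u | language X u /\ size u = S].

Definition transitive_subshift X : Prop :=
  forall u v, language X u -> language X v ->
    exists2 w, language X w & language X (u ++ w ++ v).

Definition specification_property X : Prop :=
  exists2 S : nat, (0 < S)%N &
    forall u v, language X u -> language X v ->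
      exists2 w, words_of_length X S w & language X (u ++ w ++ v).

Definition synchronised X : Prop :=
  transitive_subshift X /\
  exists2 w, language X w &
    forall u v, language X (u ++ w) -> language X (w ++ v) ->
      language X (u ++ w ++ v).

End Sequences.

Section Expansions.
Variables (R : realType) (M : nat).
Implicit Types (q : R) (x a : Sigma M).

Definition infinite_expansion_of_one q a : Prop :=
  (forall n, exists2 m, (n <= m)%N & a m != ord0) /\
  series (fun i => (a i)%:R / q ^+ i.+1) @ \oo --> (1 : R).

Definition quasi_greedy q a : Prop :=
  infinite_expansion_of_one q a /\
  forall b : Sigma M, infinite_expansion_of_one q b -> (b <= a)%O.

(* The constant sequence 0 is a junk value, only taken when there is no
   quasi-greedy expansion, hence never for [1 < q <= M + 1]. *)
Definition alpha q : Sigma M := xget (fun=> ord0) (quasi_greedy q).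

Definition calV : set R :=
  [set q | 1 < q <= M.+1%:R /\
    forall n, (reflection (alpha q) <= iter n (@sigma M) (alpha q) <= alpha q)%O].

Definition bfV q : set (Sigma M) :=
  [set x |
    forall n, (reflection (alpha q) <= iter n (@sigma M) x <= alpha q)%O].

Definition C3' : set R := [set q | calV q /\ specification_property (bfV q)].

Definition C4' : set R := [set q | calV q /\ synchronised (bfV q)].

End Expansions.

Section HausdorffDimension.
Variable R : realType.
Implicit Types (E U : set R) (s delta : R).
Local Open Scope ereal_scope.

(* The supremum of the empty set is [-oo]. *)
Definition diameter U : \bar R :=
  ereal_sup [set z | exists x y, [/\ U x, U y & z = `|x - y|%R%:E]].

(* The empty set weighs 0 even for [s = 0], where [poweR] would give 1. *)
Definition diameter_pow s U : \bar R :=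
  if U == set0 then 0 else poweR (diameter U) s.

Definition delta_cover delta E : set (set R)^nat :=
  [set U | E `<=` \bigcup_k U k /\ forall k, diameter (U k) <= delta%:E].

Definition hausdorff_premeasure delta s E : \bar R :=
  ereal_inf [set \sum_(k <oo) diameter_pow s (U k) | U in delta_cover delta E].

Definition hausdorff_measure s E : \bar R :=
  ereal_sup [set hausdorff_premeasure delta s E |
              delta in [set delta | (0 < delta)%R]].

Definition hausdorff_dim E : \bar R :=
  ereal_inf [set s%:E | s in [set s | (0 <= s)%R /\ hausdorff_measure s E = 0]].

End HausdorffDimension.

(* Main.v *)
(* A parameter [q] belongs to both sets as soon as [alpha q] is a sequence [a]
   that begins with [M^N] and contains no other [M^N], nor any [0^(N-2)].
   Indeed [0^N] is then a synchronising word.  For specification, take the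
   longest suffix of the first word that is a prefix of [a] or of its reflection,
   say of [a]; append zeros until the match with [a] breaks, then alternate [0]
   and [M] until the second word.

   Such sequences are dense enough: after [M^(L+4)], write blocks [0 M w] where
   the words [w] of length [L] spell out the base-(M+1) digits of an arbitrary
   [t] in [[0, 1[].  If two of these sequences first differ at position [n], their
   bases differ by at least a constant times [(M+1)^-n], so the inverse of the
   map from [t] to the base is Hoelder of exponent [s] whenever
   [(L + 2) s <= L].  Countable subadditivity of Lebesgue measure on [[0, 1[] then
   forbids covers of small [s]-weight, for every [s < 1]. *)
From HB Require Import structures.
Require Import Defs.
From mathcomp Require Import all_boot all_order all_algebra.
From mathcomp Require Import all_classical all_reals all_analysis.
From mathcomp Require Import zify ring lra.

Set Implicit Arguments.
Unset Strict Implicit.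
Unset Printing Implicit Defensive.

Import Order.TTheory GRing.Theory Num.Theory.
Import numFieldNormedType.Exports.

Local Open Scope classical_set_scope.
Local Open Scope ring_scope.

(** * Lexicographic order *)

Definition lex_lt M (x y : Sigma M) : Prop :=
  exists2 n, (forall i, (i < n)%N -> x i = y i) & (x n < y n)%N.

Lemma lex_ltW M (x y : Sigma M) : lex_lt x y -> (x <= y)%O.
Proof.
case=> n pfx lt_n; rewrite leEbig_lexi_order.
have -> : first_diff x y = Some n.
  apply/first_diff_SomeP; split; first by move=> i; exact: pfx.
  by rewrite -val_eqE neq_ltn lt_n.
by rewrite leEord ltnW.
Qed.

Lemma lex_le_eqVlt M (x y : Sigma M) : (x <= y)%O -> x = y \/ lex_lt x y.
Proof.
rewrite leEbig_lexi_order; case E : (first_diff x y) => [n|]; last first.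
  by move/first_diff_NoneP : E; left.
case/first_diff_SomeP : E => pfx ne_n le_n; right; exists n => [i|].
  exact: pfx.
by rewrite ltn_neqAle val_eqE ne_n.
Qed.

Lemma iter_sigmaE M n (x : Sigma M) : iter n (@sigma M) x = (fun i => x (n + i)%N).
Proof.
elim: n => [|n IH] /=; first by apply/funext.
by rewrite IH; apply/funext => i; rewrite /sigma addSnnS.
Qed.

Lemma reflectionK M : involutive (@reflection M).
Proof. by move=> x; apply/funext => i; rewrite /reflection rev_ordK. Qed.

Lemma lex_le_reflection M (x y : Sigma M) :
  (reflection x <= reflection y)%O = (y <= x)%O.
Proof.
suff H (u v : Sigma M) : (v <= u)%O -> (reflection u <= reflection v)%O.
  by apply/idP/idP => /H //; rewrite !reflectionK.
case/lex_le_eqVlt => [->//|[n pfx lt_n]]; apply: lex_ltW; exists n => [i /pfx|].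
  by rewrite /reflection => ->.
by rewrite /reflection /=; have := ltn_ord (u n); lia.
Qed.

Lemma reflection_iter_sigma M n (x : Sigma M) :
  reflection (iter n (@sigma M) x) = iter n (@sigma M) (reflection x).
Proof. by rewrite !iter_sigmaE. Qed.

(** The set [bfV q] with [alpha q] replaced by any sequence, so that words can be treated without a
    base. *)
Definition subshift_between M (a : Sigma M) : set (Sigma M) :=
  [set x | forall n, (reflection a <= iter n (@sigma M) x <= a)%O].

Lemma subshift_between_reflection M (a x : Sigma M) :
  subshift_between a x -> subshift_between a (reflection x).
Proof.
move=> Vx n; rewrite -reflection_iter_sigma lex_le_reflection.
by rewrite -{2}[a]reflectionK lex_le_reflection andbC.
Qed.

Lemma subshift_between_iter M (a x : Sigma M) p :
  subshift_between a x -> subshift_between a (iter p (@sigma M) x).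
Proof. by move=> Vx n; rewrite -iterD. Qed.

(* After its initial block [M^N], the sequence [a] contains neither [M^N] nor
   [0^K]. *)
Definition short_runs M N K (a : Sigma M) : Prop :=
  [/\ (K + 2 <= N)%N,
      forall i, (i < N)%N -> a i = ord_max,
      forall p, (0 < p)%N -> exists2 i, (i < N)%N & a (p + i)%N != ord_max &
      forall p, exists2 i, (i < K)%N & a (p + i)%N != ord0].

(** The first digit of [x] other than [ord_max] stands below [N], where [a] still reads [ord_max],
    so it decides the comparison. *)
Lemma lex_lt_short_runs M N K (a x : Sigma M) : short_runs N K a ->
  (exists2 i, (i < N)%N & x i != ord_max) -> lex_lt x a.
Proof.
case=> _ aM _ _ exN.
have ex : exists i, (i < N)%N && (x i != ord_max).
  by case: exN => i iN xi; exists i; rewrite iN.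
case: (ex_minnP ex) => n /andP[nN xn] min_n; exists n => [i lt_in|].
  rewrite aM ?(ltn_trans lt_in)//; apply/eqP; case: eqP => // /eqP xi.
  by have := min_n i; rewrite xi andbT (ltn_trans lt_in nN) leqNgt lt_in => /(_ isT).
rewrite aM// ltn_neqAle -ltnS ltn_ord andbT.
by apply: contraNneq xn => xn; apply/eqP/val_inj.
Qed.

Lemma reflection_le_short_runs M N K (a x : Sigma M) : short_runs N K a ->
  (exists2 i, (i < N)%N & x i != ord0) -> (reflection a <= x)%O.
Proof.
move=> runs [i iN xi]; rewrite -[x]reflectionK lex_le_reflection.
apply/lex_ltW/(lex_lt_short_runs runs); exists i => //.
apply: contra_neq xi => /(congr1 (@rev_ord _)).
by rewrite /reflection rev_ordK => ->; apply/val_inj; rewrite /= subnn.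
Qed.

Lemma short_runs_shift_le M N K (a : Sigma M) n : short_runs N K a ->
  (iter n (@sigma M) a <= a)%O.
Proof.
case: n => [|n] runs; first by [].
apply/lex_ltW/(lex_lt_short_runs runs); case: runs => _ _ runM _.
by have [i iN ai] := runM n.+1 isT; exists i; rewrite // iter_sigmaE.
Qed.

Lemma short_runs_mem M N K (a : Sigma M) : short_runs N K a ->
  subshift_between a a.
Proof.
move=> runs n; rewrite (short_runs_shift_le n runs) andbT.
apply: (reflection_le_short_runs runs); case: runs => KN _ _ run0.
by have [i iK ai] := run0 n; exists i; rewrite ?iter_sigmaE//; lia.
Qed.

(** * Specification and synchronisation *)

Lemma mkseqD T (f : nat -> T) m n :
  mkseq f (m + n) = mkseq f m ++ mkseq (fun i => f (m + i)%N) n.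
Proof. by rewrite /mkseq iotaD map_cat add0n -{2}[m]addn0 iotaDl -map_comp. Qed.

Lemma mkseq_eq_at (T : Type) (f g : nat -> T) n :
  mkseq f n = mkseq g n -> forall i, (i < n)%N -> f i = g i.
Proof.
move=> fg i lt_in; have := congr1 (fun s => nth (f 0%N) s i) fg.
by rewrite !nth_mkseq.
Qed.

Lemma language_subshift_between M (a : Sigma M) u :
  language (subshift_between a) u <->
  exists2 x, subshift_between a x & u = mkseq x (size u).
Proof.
split=> [[x Vx [n u_x]]|[x Vx u_x]]; last by exists x => //; exists 0%N.
by exists (iter n (@sigma M) x); [exact: subshift_between_iter|rewrite iter_sigmaE].
Qed.

(** If the digits of [x] from [p] up to [n] are not a prefix of [a], the comparison of the shifted
    [x] with [a] is decided before [n], and every [z] sharing these digits inherits the result. *)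
Lemma le_of_mismatch M (a x z : Sigma M) p n : subshift_between a x ->
  (forall i, (i < n)%N -> z i = x i) ->
  ~ (forall i, (p + i < n)%N -> x (p + i)%N = a i) ->
  (iter p (@sigma M) z <= a)%O.
Proof.
move=> Vx zx mism.
have [_ /lex_le_eqVlt] := andP (Vx p); rewrite !iter_sigmaE => -[eq_xa|[j pfx lt_j]].
  by case: mism => i _; rewrite -eq_xa.
have jn : (p + j < n)%N.
  rewrite ltnNge; apply/negP => le_n; apply: mism => i lt_i; apply: pfx; lia.
apply: lex_ltW; exists j => [i lt_ij|]; last by rewrite zx.
by rewrite zx ?pfx//; lia.
Qed.

Lemma ge_of_mismatch M (a x z : Sigma M) p n : subshift_between a x ->
  (forall i, (i < n)%N -> z i = x i) ->
  ~ (forall i, (p + i < n)%N -> x (p + i)%N = reflection a i) ->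
  (reflection a <= iter p (@sigma M) z)%O.
Proof.
move=> /subshift_between_reflection Vx zx mism.
rewrite -[iter _ _ _]reflectionK lex_le_reflection reflection_iter_sigma.
apply: (le_of_mismatch (n := n) Vx) => [i lt_in|match_a].
  by rewrite /reflection zx.
by apply: mism => i /match_a e; rewrite /reflection -e /reflection rev_ordK.
Qed.

Lemma subshift_between_tail M (a y z : Sigma M) n p : subshift_between a y ->
  (forall i, z (n + i)%N = y i) -> (n <= p)%N ->
  (reflection a <= iter p (@sigma M) z <= a)%O.
Proof.
move=> Vy zy le_np; have := Vy (p - n)%N; rewrite !iter_sigmaE.
suff -> : (fun i => z (p + i)%N) = (fun i => y (p - n + i)%N) by [].
by apply/funext => i; rewrite -zy; congr z; lia.
Qed.

(* [0^N] is synchronising: it does not occur in [a], and occurs in the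
   reflection of [a] only as a prefix, so a comparison started before it is
   decided before its end. *)
Lemma synchronising_zeros M N K (a : Sigma M) : short_runs N K a ->
  exists2 w, language (subshift_between a) w &
    forall u v, language (subshift_between a) (u ++ w) ->
      language (subshift_between a) (w ++ v) ->
      language (subshift_between a) (u ++ w ++ v).
Proof.
move=> runs; have [KN aM runM run0] := runs.
have r0 (i : nat) : (i < N)%N -> reflection a i = ord0.
  by move=> /aM e; apply/val_inj; rewrite /reflection e /= subnn.
exists (nseq N ord0) => [|u v].
  apply/language_subshift_between; exists (reflection a).
    exact/subshift_between_reflection/(short_runs_mem runs).
  rewrite size_nseq; apply: (@eq_from_nth _ ord0); first by rewrite size_mkseq size_nseq.
  by move=> i; rewrite size_nseq => lt_iN; rewrite nth_nseq lt_iN nth_mkseq// r0.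
move=> /language_subshift_between[x Vx] + /language_subshift_between[y Vy].
rewrite !size_cat size_nseq => /esym ux /esym vy.
set n := size u in ux.
have [] : mkseq x n = u /\ mkseq (fun i => x (n + i)%N) N = nseq N ord0.
  by move/eqP: ux; rewrite mkseqD eqseq_cat ?size_mkseq// => /andP[/eqP-> /eqP->].
move=> ux1 ux2.
have [] : mkseq y N = nseq N ord0 /\ mkseq (fun i => y (N + i)%N) (size v) = v.
  move/eqP: vy; rewrite mkseqD eqseq_cat ?size_mkseq ?size_nseq//.
  by move=> /andP[/eqP-> /eqP->].
move=> vy1 vy2.
(* The two occurrences of [0^N] are superimposed: [z] agrees with [x] up to [n + N] and with [y]
   from [n] on. *)
pose z : Sigma M := fun i => if (i < n)%N then x i else y (i - n)%N.
have zy i : z (n + i)%N = y i by rewrite /z -ltn_subRL subnn ltn0 addKn.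
have xy i : (i < N)%N -> x (n + i)%N = y i.
  by apply: (@mkseq_eq_at _ (fun i => x (n + i)%N)); rewrite ux2 vy1.
have x0 i : (i < N)%N -> x (n + i)%N = ord0.
  move=> lt_i; have := congr1 (fun s => nth ord0 s i) ux2.
  by rewrite nth_mkseq// nth_nseq lt_i.
have zx i : (i < n + N)%N -> z i = x i.
  move=> lt_i; rewrite /z; case: ltnP => // le_ni.
  by rewrite -xy ?subnKC// ltn_subLR.
apply/language_subshift_between; exists z; last first.
  rewrite !size_cat size_nseq -/n !mkseqD -{1}ux1 -{1}vy1 -{1}vy2.
  congr (_ ++ _); last congr (_ ++ _).
  - apply/eq_in_map => i; rewrite mem_iota => /andP[_ lt_i].
    by rewrite zx// ltn_addr.
  - by apply: eq_map => i; rewrite zy.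
  - by apply: eq_map => i; rewrite zy.
move=> p; case: (leqP n p) => [le_np|lt_pn].
  exact: (subshift_between_tail Vy zy).
apply/andP; split.
  (* A match up to [n + N] would put [0^N] into the reflection of [a] at the positive position
     [n - p], hence a second [M^N] into [a]. *)
  apply: (ge_of_mismatch (n := n + N) Vx zx) => match_a.
  have d_gt0 : (0 < n - p)%N by rewrite subn_gt0.
  have [i iN /eqP] := runM _ d_gt0; apply.
  have := match_a (n - p + i)%N; rewrite addnA subnKC ?(ltnW lt_pn)// ltn_add2l.
  move=> /(_ iN); rewrite x0// /reflection => /(congr1 (@rev_ord _)).
  by rewrite rev_ordK => <-; apply/val_inj; rewrite /= subn1.
(* Here a match would put [0^N] into [a] itself, which has no [0^K]. *)
apply: (le_of_mismatch (n := n + N) Vx zx) => match_a.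
have [i iK /eqP] := run0 (n - p)%N; apply.
have := match_a (n - p + i)%N; rewrite addnA subnKC ?(ltnW lt_pn)// ltn_add2l.
by move=> <-; rewrite ?x0//; lia.
Qed.

(* The match of [a] starting at [p0] is the longest; writing 0 up to and including
   the place of the next nonzero digit of [a] breaks it from below. *)
Lemma glue_past_alpha M N K (a x y : Sigma M) n p0 : (0 < M)%N ->
  short_runs N K a -> subshift_between a x -> subshift_between a y ->
  (p0 <= n)%N -> (forall i, (p0 + i < n)%N -> x (p0 + i)%N = a i) ->
  (forall p, (p < p0)%N ->
     ~ (forall i, (p + i < n)%N -> x (p + i)%N = a i) /\
     ~ (forall i, (p + i < n)%N -> x (p + i)%N = reflection a i)) ->
  exists2 z, subshift_between a z &
    (forall i, (i < n)%N -> z i = x i) /\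
    (forall i, z (n + N.+2 + i)%N = y i).
Proof.
move=> M0 runs Vx Vy le_p0n match0 nomatch; have [KN aM runM run0] := runs.
set k := (n - p0)%N.
have ex : exists m, (k <= m)%N && (a m != ord0).
  by have [i _ ai] := run0 k; exists (k + i)%N; rewrite leq_addr.
case: (ex_minnP ex) => m /andP[km am] min_m.
have a0 i : (k <= i < m)%N -> a i = ord0.
  move=> /andP[ki im]; apply/eqP; apply: contraTT im => ai.
  by rewrite -leqNgt min_m// ki.
have mkK : (m < k + K)%N.
  have [i iK ai] := run0 k; apply: leq_ltn_trans (_ : (k + i < _)%N).
    by apply: min_m; rewrite leq_addr.
  by rewrite ltn_add2l.
(* The zeros include the place of [m], where [a] is nonzero; by [mkK] there are at most [K] of
   them. *)
set c := (m - k).+1.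
pose S := N.+2.
have ne0M : ord_max != ord0 :> 'I_M.+1 by rewrite -val_eqE /= -lt0n.
(* The alternating filler has its parity fixed backwards from [y]: its last digit is the maximum
   exactly when [y] starts with 0, so neither [0 0] nor [M M] arises at the seam with [y]. *)
pose z : Sigma M := fun i => if (i < n)%N then x i
  else if (i < n + c)%N then ord0
  else if (i < n + S)%N then
    (if odd (n + S - i.+1) (+) (y 0%N == ord0) then ord_max else ord0)
  else y (i - (n + S))%N.
have zx i : (i < n)%N -> z i = x i by rewrite /z => ->.
have zy i : z (n + S + i)%N = y i.
  rewrite /z !ifF ?addKn//; apply/negbTE; rewrite -leqNgt; first last.
  - lia.
  - rewrite -addnA leq_add2l; rewrite /c /S; lia.
  - lia.
have z0 i : (n <= i < n + c)%N -> z i = ord0.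
  by rewrite /z => /andP[ni ->]; rewrite ltnNge ni.
have zmix i : (n + c <= i < n + S)%N ->
    (z i != ord_max \/ z i.+1 != ord_max) /\ (z i != ord0 \/ z i.+1 != ord0).
  move=> /andP[ci iS].
  have zE j : (n + c <= j < n + S)%N -> z j =
      if odd (n + S - j.+1) (+) (y 0%N == ord0) then ord_max else ord0.
    move=> /andP[cj jS]; rewrite /z jS [(j < n + c)%N]ltnNge cj ltnNge.
    by rewrite (leq_trans (leq_addr c n) cj).
  case: (ltnP i.+1 (n + S)) => [iS'|Si].
    rewrite !zE ?ci ?iS ?iS' ?(leq_trans ci)//.
    have -> : (n + S - i.+1 = (n + S - i.+2).+1)%N by lia.
    rewrite oddS; case: (odd _); case: (y 0%N == ord0) => /=;
      by rewrite ne0M eq_sym ne0M; split; [(left + right)|(left + right)].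
  have -> : i.+1 = (n + S + 0)%N by lia.
  rewrite zy zE ?ci// (_ : n + S - i.+1 = 0)%N /=; last by lia.
  have [->|ne0] := eqVneq (y 0%N) ord0.
    by rewrite ne0M eq_sym ne0M; split; [right|left].
  by rewrite eq_sym ne0M; split; [left|right].
(* The parity may make the first filler digit another 0, hence two candidate positions. *)
have znonzero : exists2 i, (i < 2)%N & z (n + c + i)%N != ord0.
  case: (zmix (n + c)%N); first by rewrite /c /S; lia.
  by move=> _ [zc|zc]; [exists 0%N|exists 1%N]; rewrite ?addn0 ?addn1.
exists z; last by split.
move=> p; case: (leqP (n + S) p) => [le_np|lt_pS].
  exact: (subshift_between_tail Vy zy).
case: (leqP n p) => [le_np|lt_pn].
  case: (ltnP p (n + c)) => [lt_pc|le_cp].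
    have zp := z0 p; rewrite le_np lt_pc in zp.
    apply/andP; split.
      (* From inside the zeros, a nonzero digit comes at offset at most [K + 1], which is below [N]
         since [K + 2 <= N]. *)
      apply: (reflection_le_short_runs runs); have [i i2 zi] := znonzero.
      exists (n + c + i - p)%N; first by rewrite /c; lia.
      by rewrite iter_sigmaE subnKC//; lia.
    apply/lex_ltW/(lex_lt_short_runs runs); exists 0%N; first by lia.
    by rewrite iter_sigmaE addn0 zp// eq_sym.
  case: (zmix p); first by rewrite le_cp.
  move=> zM zn0; apply/andP; split.
    apply: (reflection_le_short_runs runs); case: zn0 => zp; [exists 0%N|exists 1%N];
      by rewrite ?iter_sigmaE ?addn0 ?addn1//; lia.
  apply/lex_ltW/(lex_lt_short_runs runs); case: zM => zp; [exists 0%N|exists 1%N];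
    by rewrite ?iter_sigmaE ?addn0 ?addn1//; lia.
apply/andP; split.
  have [match_r|] := pselect (forall i, (p + i < n)%N -> x (p + i)%N = reflection a i);
    last exact: (ge_of_mismatch Vx zx).
  have le_p0p : (p0 <= p)%N.
    by rewrite leqNgt; apply/negP => /nomatch[_]; apply.
  have lt_p0p : (p0 < p)%N.
    rewrite ltn_neqAle le_p0p andbT; apply/negP => /eqP e.
    have := match_r 0%N; rewrite addn0 => /(_ lt_pn); rewrite -e.
    have := match0 0%N; rewrite addn0 e => /(_ lt_pn) ->.
    rewrite /reflection aM; last by lia.
    by move=> /(congr1 val) /=; lia.
  (* Otherwise [a] would contain [0^K] from [p - p0]: before [k] its digits are those of [x], that
     is leading zeros of the reflection, and from [k] up to [m] they vanish. *)
  have le_md : (m < p - p0 + K)%N.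
    have [i iK ai] := run0 (p - p0)%N; apply: leq_ltn_trans (_ : p - p0 + i < _)%N.
      rewrite leqNgt; apply/negP => lt_m; move: ai.
      case: (ltnP (p - p0 + i) k) => [lt_k|le_k]; last first.
        by rewrite a0 ?le_k// eqxx.
      rewrite -match0; last by lia.
      rewrite addnA subnKC// match_r; last by lia.
      rewrite /reflection aM; last by lia.
      by rewrite -val_eqE /= subnn.
    by rewrite ltn_add2l.
  apply: (reflection_le_short_runs runs); have [i i2 zi] := znonzero.
  exists (n + c + i - p)%N; first by rewrite /c; lia.
  by rewrite iter_sigmaE subnKC//; lia.
have [match_a|] := pselect (forall i, (p + i < n)%N -> x (p + i)%N = a i);
  last exact: (le_of_mismatch Vx zx).
have : (p0 <= p)%N by rewrite leqNgt; apply/negP => /nomatch[+ _]; apply.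
(* From [p0], [z] follows [a] up to [m] and then reads 0 below a nonzero digit. From a later start,
   the 0 at [n] comes within [N] digits, since otherwise the two matches would put a second [M^N]
   into [a]. *)
rewrite leq_eqVlt => /predU1P[e|lt_p0p].
  apply: lex_ltW; exists m => [i lt_im|]; rewrite iter_sigmaE -e.
    case: (ltnP (p0 + i) n) => [lt_n|le_n]; first by rewrite zx// match0.
    by rewrite z0 ?a0//; rewrite /c; lia.
  by rewrite z0 ?lt0n//; rewrite /c; lia.
apply/lex_ltW/(lex_lt_short_runs runs); exists (n - p)%N; last first.
  by rewrite iter_sigmaE subnKC 1?ltnW// z0 1?eq_sym//; rewrite /c; lia.
have d_gt0 : (0 < p - p0)%N by rewrite subn_gt0.
have [i iN /eqP ai] := runM _ d_gt0; rewrite ltnNge; apply/negP => le_N.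
apply: ai; rewrite -match0; last by lia.
by rewrite addnA subnKC 1?ltnW// match_a ?aM//; lia.
Qed.

(* Whichever of [a] and its reflection has the longer prefix matching the end
   of the first word, break that match; reflecting exchanges the two cases. *)
Lemma glue M N K (a x y : Sigma M) n : (0 < M)%N ->
  short_runs N K a -> subshift_between a x -> subshift_between a y ->
  exists2 z, subshift_between a z &
    (forall i, (i < n)%N -> z i = x i) /\
    (forall i, z (n + N.+2 + i)%N = y i).
Proof.
move=> M0 runs Vx Vy.
pose matches (b : Sigma M) p := forall i, (p + i < n)%N -> x (p + i)%N = b i.
have ex : exists p, `[< matches a p \/ matches (reflection a) p >].
  by exists n; apply/asboolP; left=> i; rewrite ltnNge leq_addr.
case: (ex_minnP ex) => p0 /asboolP match0 min_p0.
have le_p0n : (p0 <= n)%N.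
  by apply: min_p0; apply/asboolP; left=> i; rewrite ltnNge leq_addr.
have nomatch p : (p < p0)%N -> ~ matches a p /\ ~ matches (reflection a) p.
  move=> lt_p; apply/not_orP => match_p; move: lt_p; rewrite ltnNge => /negP; apply.
  by apply: min_p0; apply/asboolP.
case: match0 => [match_a|match_r].
  exact: (glue_past_alpha M0 runs Vx Vy le_p0n match_a nomatch).
have match_rx i : (p0 + i < n)%N -> reflection x (p0 + i)%N = a i.
  by move/match_r => e; rewrite /reflection e /reflection rev_ordK.
have nomatch_rx p : (p < p0)%N ->
    ~ (forall i, (p + i < n)%N -> reflection x (p + i)%N = a i) /\
    ~ (forall i, (p + i < n)%N -> reflection x (p + i)%N = reflection a i).
  move=> /nomatch[na nr]; split=> match_p.
    by apply: nr => i /match_p e; rewrite /reflection -e /reflection rev_ordK.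
  by apply: na => i /match_p /(@rev_ord_inj _).
have [z Vz [zx zy]] := glue_past_alpha M0 runs (subshift_between_reflection Vx)
  (subshift_between_reflection Vy) le_p0n match_rx nomatch_rx.
exists (reflection z); first exact: subshift_between_reflection.
by split=> i => [/zx e|]; rewrite {1}/reflection ?e ?zy /reflection rev_ordK.
Qed.

Lemma language_factor M (X : set (Sigma M)) (u w v : seq 'I_M.+1) :
  language X (u ++ w ++ v) -> language X w.
Proof.
move=> [x Xx [n e]]; exists x => //; exists (n + size u)%N.
move: e; rewrite !size_cat !mkseqD => /eqP; rewrite !eqseq_cat ?size_mkseq//.
move=> /and3P[_ /eqP w_x _]; rewrite [LHS]w_x.
by apply: eq_map => i; rewrite addnA.
Qed.

Lemma specification_short_runs M N K (a : Sigma M) : (0 < M)%N ->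
  short_runs N K a -> specification_property (subshift_between a).
Proof.
move=> M0 runs; exists N.+2 => // u v.
move=> /language_subshift_between[x Vx ux] /language_subshift_between[y Vy vy].
have [z Vz [zx zy]] := glue (size u) M0 runs Vx Vy.
set w := mkseq (fun i => z (size u + i)%N) N.+2.
have Luwv : language (subshift_between a) (u ++ w ++ v).
  apply/language_subshift_between; exists z => //.
  rewrite !size_cat size_mkseq !mkseqD; congr (_ ++ (_ ++ _)).
    rewrite [LHS]ux; apply/eq_in_map => i; rewrite mem_iota => /andP[_ lt_i].
    by rewrite zx.
  by rewrite [LHS]vy; apply: eq_map => i; rewrite addnA zy.
exists w => //; split; first exact: language_factor Luwv.
by rewrite size_mkseq.
Qed.

Lemma synchronised_short_runs M N K (a : Sigma M) : (0 < M)%N ->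
  short_runs N K a -> synchronised (subshift_between a).
Proof.
move=> M0 runs; split; last exact: synchronising_zeros runs.
move=> u v Lu Lv; have [S _ spec] := specification_short_runs M0 runs.
by have [w [Lw _] Luwv] := spec u v Lu Lv; exists w.
Qed.

(** * Expansions of 1 *)

(* The variable [x] stands for the inverse of the base. *)
Definition expansion (R : realType) M (a : Sigma M) (x : R) : R :=
  limn (series (fun i => (a i)%:R * x ^+ i.+1)).

Lemma expansion_term_ge0 (R : realType) M (a : Sigma M) (x : R) i : 0 <= x ->
  0 <= (a i)%:R * x ^+ i.+1.
Proof. by move=> x0; rewrite mulr_ge0 ?exprn_ge0. Qed.

Lemma expansion_term_le (R : realType) M (a : Sigma M) (x : R) i : 0 <= x ->
  (a i)%:R * x ^+ i.+1 <= geometric (M%:R * x) x i.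
Proof.
move=> x0; rewrite /geometric /= exprS mulrA ler_wpM2r ?exprn_ge0//.
by rewrite ler_wpM2r// ler_nat -ltnS.
Qed.

Lemma cvg_expansion (R : realType) M (a : Sigma M) (x : R) : 0 <= x < 1 ->
  series (fun i => (a i)%:R * x ^+ i.+1) @ \oo --> expansion a x.
Proof.
move=> /andP[x0 x1]; apply: (@series_le_cvg _ _ (geometric (M%:R * x) x)).
- by move=> i; exact: expansion_term_ge0.
- by move=> i; rewrite /geometric /= !mulr_ge0 ?exprn_ge0.
- by move=> i; exact: expansion_term_le.
- by apply: is_cvg_geometric_series; rewrite ger0_norm.
Qed.

Lemma expansion_ge0 (R : realType) M (a : Sigma M) (x : R) : 0 <= x < 1 ->
  0 <= expansion a x.
Proof.
move=> x01; have /andP[x0 _] := x01.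
apply: limr_ge; first exact: (cvgP _ (cvg_expansion x01)).
by apply: nearW => n; apply: sumr_ge0 => i _; exact: expansion_term_ge0.
Qed.

Lemma expansion_le (R : realType) M (a : Sigma M) (x : R) : 0 < x < 1 ->
  expansion a x <= M%:R * x / (1 - x).
Proof.
move=> /andP[x0 x1]; have x01 : 0 <= x < 1 by rewrite ltW.
apply: limr_le; first exact: (cvgP _ (cvg_expansion x01)).
apply: nearW => n.
have Nx : `|x| < 1 by rewrite ger0_norm ?ltW.
apply: le_trans (geometric_le_lim n _ x0 Nx); last by rewrite mulr_ge0// ltW.
by apply: ler_sum => i _; exact: expansion_term_le (ltW x0).
Qed.

Lemma expansion_sigma (R : realType) M (a : Sigma M) (x : R) : 0 <= x < 1 ->
  expansion a x = x * ((a 0%N)%:R + expansion (sigma a) x).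
Proof.
move=> x01; apply: (cvg_lim (@Rhausdorff R)); rewrite -cvg_shiftS.
rewrite (_ : [sequence _]_n = fun n => x * ((a 0%N)%:R +
    series (fun i => (sigma a i)%:R * x ^+ i.+1) n)).
  by apply: cvgMr; apply: cvgD; [exact: cvg_cst|exact: cvg_expansion].
apply/funext => n; rewrite /series /= big_nat_recl//= mulrDr mulrC expr1.
congr (_ + _); rewrite mulr_sumr; apply: eq_bigr => i _.
by rewrite /sigma [x ^+ i.+2]exprS mulrCA.
Qed.

Lemma expansion_split (R : realType) M (a : Sigma M) (x : R) n : 0 <= x < 1 ->
  expansion a x = \sum_(i < n) (a i)%:R * x ^+ i.+1 +
                  x ^+ n * expansion (iter n (@sigma M) a) x.
Proof.
move=> x01; elim: n => [|n IH]; first by rewrite big_ord0 add0r expr0 mul1r.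
rewrite IH big_ord_recr /= expansion_sigma// iter_sigmaE addn0 exprSr -addrA.
by congr (_ + _); ring.
Qed.

Lemma expansion_diff (R : realType) M (a b : Sigma M) (x : R) n : 0 <= x < 1 ->
  (forall i, (i < n)%N -> a i = b i) ->
  expansion b x - expansion a x =
    x ^+ n.+1 * ((b n)%:R - (a n)%:R + (expansion (iter n.+1 (@sigma M) b) x -
                                        expansion (iter n.+1 (@sigma M) a) x)).
Proof.
move=> x01 pfx; rewrite (expansion_split b n.+1 x01) (expansion_split a n.+1 x01).
rewrite !big_ord_recr /=.
have -> : \sum_(i < n) (a i)%:R * x ^+ i.+1 = \sum_(i < n) (b i)%:R * x ^+ i.+1.
  by apply: eq_bigr => i _; rewrite pfx.
by ring.
Qed.

Lemma expansion_digit_le (R : realType) M (a : Sigma M) (x : R) i : 0 <= x < 1 ->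
  a i != ord0 -> x ^+ i.+1 <= expansion a x.
Proof.
move=> x01 ai; have /andP[x0 _] := x01.
rewrite (expansion_split a i.+1 x01) big_ord_recr /=.
have ai1 : (1 : R) <= (a i)%:R by rewrite ler1n lt0n.
rewrite -addrA ler_wpDl ?sumr_ge0//= => [j _|]; first exact: expansion_term_ge0.
rewrite ler_wpDr ?mulr_ge0 ?exprn_ge0 ?expansion_ge0//.
by rewrite ler_peMl ?exprn_ge0.
Qed.

(** Iterated improvement: suppose all tails have value at most [1 + B x^j]. At its first difference
    from [a], a tail loses at least 1 in the digit, and what follows is at most [1 + B x^j]; so its
    value is at most [1 + B x^(j+1)]. Letting [j] grow gives 1. *)
Lemma expansion_shift_le1 (R : realType) M (a : Sigma M) (x : R) : 0 < x < 1 ->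
  expansion a x = 1 -> (forall n, (iter n (@sigma M) a <= a)%O) ->
  forall n, expansion (iter n (@sigma M) a) x <= 1.
Proof.
move=> x01 a1 a_max n; have /andP[x0 x1] := x01.
have x01' : 0 <= x < 1 by rewrite ltW.
set B := M%:R * x / (1 - x).
have B0 : 0 <= B by rewrite divr_ge0 ?mulr_ge0// ?subr_ge0 ltW.
have bound j m : expansion (iter m (@sigma M) a) x <= 1 + B * x ^+ j.
  elim: j m => [|j IH] m.
    by rewrite expr0 mulr1 (le_trans (expansion_le _ x01))// lerDr.
  have /lex_le_eqVlt[->|[k pfx lt_k]] := a_max m.
    by rewrite a1 lerDl mulr_ge0 ?exprn_ge0// ltW.
  have := expansion_diff x01' pfx; rewrite a1 -iterD.
  have := expansion_ge0 (iter k.+1 (@sigma M) a) x01'; have := IH (k.+1 + m)%N.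
  have : (1 : R) <= (a k)%:R - (iter m (@sigma M) a k)%:R.
    by rewrite lerBrDr nat1r ler_nat.
  set D := _%:R - _; set u := expansion (iter k.+1 _ a) x.
  set v := expansion (iter (k.+1 + m) _ a) x; set w := expansion _ x.
  set P := x ^+ k.+1 => D1 v_le u0 w_eq.
  have P0 : 0 <= P by rewrite exprn_ge0 ?ltW.
  have Px : P <= x by rewrite /P exprS ler_piMr ?exprn_ile1 ?ltW.
  have : P * (- (B * x ^+ j)) <= P * (D + (u - v)) by rewrite ler_wpM2l//; lra.
  have : P * (B * x ^+ j) <= x * (B * x ^+ j).
    by rewrite ler_wpM2r// mulr_ge0// exprn_ge0// ltW.
  by rewrite -w_eq exprS; lra.
rewrite -subr_le0.
have := @cvg_geometric R B x; rewrite ger0_norm ?(ltW x0)// => /(_ x1) cvg0.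
rewrite -(cvg_lim (@Rhausdorff R) cvg0); apply: limr_ge; first exact: (cvgP _ cvg0).
by apply: nearW => j; rewrite lerBlDl; exact: bound.
Qed.

(** A larger [b] with infinitely many nonzero digits would gain at least 1 at the first difference,
    plus a positive tail, while the tail of [a] there is at most 1; its value would exceed 1. *)
Lemma quasi_greedy_expansion (R : realType) M (a : Sigma M) (x : R) : 0 < x < 1 ->
  expansion a x = 1 -> (forall n, (iter n (@sigma M) a <= a)%O) ->
  (forall n, exists2 m, (n <= m)%N & a m != ord0) ->
  quasi_greedy x^-1 a.
Proof.
move=> x01 a1 a_max a_inf; have /andP[x0 x1] := x01.
have x01' : 0 <= x < 1 by rewrite ltW.
have seriesE (b : Sigma M) : series (fun i => (b i)%:R / x^-1 ^+ i.+1) =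
    series (fun i => (b i)%:R * x ^+ i.+1).
  by congr series; apply/funext => i; rewrite -exprVn invrK.
split.
  by split; rewrite // seriesE; have := @cvg_expansion R M a x x01'; rewrite a1.
move=> b [b_inf]; rewrite seriesE => /(cvg_lim (@Rhausdorff R)).
rewrite -[lim _]/(expansion b x) => b1.
have [//|/lex_le_eqVlt[->//|[n pfx lt_n]]] := orP (le_total b a).
have ediff := expansion_diff x01' pfx.
have [m le_nm bm] := b_inf n.+1.
have b_pos : 0 < expansion (iter n.+1 (@sigma M) b) x.
  apply: lt_le_trans (_ : x ^+ (m - n.+1).+1 <= _); first by rewrite exprn_gt0.
  by apply: expansion_digit_le; rewrite // iter_sigmaE subnKC.
have a_le := expansion_shift_le1 x01 a1 a_max n.+1.
have d1 : (1 : R) <= (b n)%:R - (a n)%:R by rewrite lerBrDr nat1r ler_nat.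
have : 0 < expansion b x - expansion a x.
  by rewrite ediff mulr_gt0 ?exprn_gt0//; lra.
by rewrite a1 b1 subrr ltxx.
Qed.

Lemma alpha_eq (R : realType) M (q : R) (a : Sigma M) :
  quasi_greedy q a -> alpha M q = a.
Proof.
move=> [a1 a_max]; rewrite /alpha; case: xgetP => [b _ [b1 b_max]|/(_ a)[]] //.
by apply/le_anti; rewrite a_max// b_max.
Qed.

(** * Lipschitz dependence on the inverse base, and existence of a root *)

Lemma expn_diff_le (R : realType) (x y r : R) i : 0 <= y -> y <= x -> x <= r ->
  x ^+ i.+1 - y ^+ i.+1 <= (x - y) * ((i.+1)%:R * r ^+ i).
Proof.
move=> y0 yx xr; have x0 := le_trans y0 yx; have r0 := le_trans x0 xr.
elim: i => [|i IH]; first by rewrite !expr1 expr0 !mulr1.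
have yr : y ^+ i.+1 <= r ^+ i.+1 by rewrite lerXn2r ?nnegrE// (le_trans yx).
have := ler_wpM2l x0 IH.
have : x * ((x - y) * ((i.+1)%:R * r ^+ i)) <= r * ((x - y) * ((i.+1)%:R * r ^+ i)).
  by rewrite ler_wpM2r// !mulr_ge0 ?subr_ge0 ?exprn_ge0.
have : (x - y) * y ^+ i.+1 <= (x - y) * r ^+ i.+1 by rewrite ler_wpM2l ?subr_ge0.
rewrite [x ^+ i.+2]exprS [y ^+ i.+2]exprS -[(i.+2)%:R]natr1 [r ^+ i.+1]exprS.
set X := x ^+ i.+1; set Y := y ^+ i.+1; set Z := r ^+ i; set k := i.+1%:R.
nra.
Qed.

Lemma sum_expn_weighted_le (R : realType) (r : R) n : 0 <= r < 1 ->
  \sum_(0 <= i < n) (i.+1)%:R * r ^+ i <= (1 - r) ^- 2.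
Proof.
move=> /andP[r0 r1]; rewrite -[leRHS]mul1r ler_pdivlMr ?exprn_gt0 ?subr_gt0//.
suff -> : (\sum_(0 <= i < n) (i.+1)%:R * r ^+ i) * (1 - r) ^+ 2 =
    1 - (n.+1)%:R * r ^+ n + n%:R * r ^+ n.+1.
  have : n%:R * (r * r ^+ n) <= n%:R * (1 * r ^+ n).
    by rewrite ler_wpM2l// ler_wpM2r ?exprn_ge0// ltW.
  have : 0 <= r ^+ n by rewrite exprn_ge0.
  by rewrite exprS -natr1; lra.
elim: n => [|n IH]; first by rewrite big_geq// expr0; ring.
by rewrite big_nat_recr//= mulrDl IH !exprS -!natr1; ring.
Qed.

(** Termwise bounds are summed with the differentiated geometric series. The lower bound is
    monotonicity, the upper one a Lipschitz bound on [[0, r]]. *)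
Lemma expansion_diff_le (R : realType) M (a : Sigma M) (x y r : R) :
  0 <= y -> y <= x -> x <= r -> r < 1 ->
  0 <= expansion a x - expansion a y <= M%:R * (1 - r) ^- 2 * (x - y).
Proof.
move=> y0 yx xr r1; have x0 := le_trans y0 yx; have r0 := le_trans x0 xr.
have x1 := le_lt_trans xr r1.
have cx := @cvg_expansion R M a x; rewrite x0 x1 in cx.
have cy := @cvg_expansion R M a y; rewrite y0 (le_lt_trans yx) // in cy.
have cxy : (series (fun i => (a i)%:R * x ^+ i.+1) -
    series (fun i => (a i)%:R * y ^+ i.+1)) @ \oo --> expansion a x - expansion a y.
  by apply: cvgB; [exact: cx|exact: cy].
rewrite -(cvg_lim (@Rhausdorff R) cxy); apply/andP; split.
  apply: limr_ge; first exact: (cvgP _ cxy).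
  apply: nearW => n; rewrite subr_ge0; apply: ler_sum => i _.
  by rewrite ler_wpM2l// lerXn2r.
apply: limr_le; first exact: (cvgP _ cxy).
apply: nearW => n.
apply: le_trans (_ : M%:R * (\sum_(0 <= i < n) (i.+1)%:R * r ^+ i) * (x - y) <= _).
  rewrite -[leLHS]/(series _ n - series _ n) /series /= -sumrB.
  rewrite mulr_sumr mulr_suml; apply: ler_sum => i _.
  rewrite -mulrBr -mulrA [_ * (x - y)]mulrC.
  apply: ler_pM => //; first by rewrite subr_ge0 lerXn2r.
    by rewrite ler_nat -ltnS.
  exact: expn_diff_le.
rewrite ler_wpM2r ?subr_ge0// ler_wpM2l// sum_expn_weighted_le//.
by rewrite r0.
Qed.

(** At 2/3 the first two digits already contribute [2/3 + 4/9 > 1], and at 0 the value is 0. The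
    common bound 2/3 gives one Lipschitz constant for all roots. *)
Lemma expansion_root (R : realType) M (a : Sigma M) :
  a 0%N != ord0 -> a 1%N != ord0 ->
  exists2 x : R, 0 < x <= 2 / 3 & expansion a x = 1.
Proof.
move=> a0 a1; pose r : R := 2 / 3.
have r0 : 0 <= r by rewrite /r; lra.
have r1 : r < 1 by rewrite /r; lra.
have r01 : 0 <= r < 1 by rewrite r0.
pose C : R := M%:R * (1 - r) ^- 2.
have C0 : 0 <= C by rewrite mulr_ge0// invr_ge0 exprn_ge0// subr_ge0 ltW.
have lip x y : x \in `[0, r] -> y \in `[0, r] ->
    `|expansion a x - expansion a y| <= C * `|x - y|.
  rewrite !in_itv /= => /andP[x0 xr] /andP[y0 yr].
  wlog yx : x y x0 xr y0 yr / y <= x => [H|].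
    have [|/ltW] := leP y x; first exact: H.
    by rewrite distrC [`|x - y|]distrC; exact: H.
  have /andP[d0 dC] := expansion_diff_le a y0 yx xr r1.
  by rewrite !ger0_norm// subr_ge0.
have [|||x xr x1] := @IVT R (expansion a) 0 r 1 => //.
- apply/subspace_continuousP => x xr; apply/cvgrPdist_le => e e0.
  near=> y; apply: le_trans (lip _ _ _ _) _ => //.
    by near: y; exact: withinT.
  apply: le_trans (_ : (C + 1) * `|x - y| <= _).
    by rewrite ler_wpM2r// lerDl.
  rewrite -ler_pdivlMl ?ltr_wpDl// mulrC.
  near: y; apply: cvg_within.
  have eC : 0 < e / (C + 1) by rewrite divr_gt0// ltr_wpDl.
  by exists (e / (C + 1)) => // y /= /ltW.
- have -> : expansion a (0 : R) = 0.
    by rewrite expansion_sigma ?mul0r// lexx ltr01.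
  rewrite ge_min ler01 /= le_max; apply/orP; right.
  rewrite (expansion_split a 2 r01) !big_ord_recr big_ord0 /= add0r.
  have a0' : (1 : R) <= (a 0%N)%:R by rewrite ler1n lt0n.
  have a1' : (1 : R) <= (a 1%N)%:R by rewrite ler1n lt0n.
  rewrite ler_wpDr ?mulr_ge0 ?exprn_ge0 ?expansion_ge0//.
  by rewrite /r; nra.
exists x => //; move: xr; rewrite in_itv /= => /andP[x0 ->]; rewrite andbT.
rewrite lt_neqAle x0 andbT; apply/eqP => x_eq0; move: x1.
by rewrite -x_eq0 expansion_sigma ?lexx ?ltr01// mul0r => /eqP; rewrite eq_sym oner_eq0.
Unshelve. all: by end_near. Qed.

Lemma root_ge (R : realType) M (a : Sigma M) (x : R) : 0 < x < 1 ->
  expansion a x = 1 -> (M.+1%:R)^-1 <= x.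
Proof.
move=> x01 a1; have /andP[x0 x1] := x01; have := expansion_le a x01.
rewrite a1 ler_pdivlMr ?subr_gt0// mul1r lerBlDr => le1.
by rewrite -[_^-1]mul1r ler_pdivrMr// -natr1 mulrDr mulr1 mulrC.
Qed.

(** * Hausdorff dimension *)

Lemma diameter_pow_ge0 (R : realType) (s : R) (U : set R) :
  (0 <= diameter_pow s U)%E.
Proof. by rewrite /diameter_pow; case: ifP => // _; exact: poweR_ge0. Qed.

Lemma diameter_ge0 (R : realType) (U : set R) x : U x -> (0 <= diameter U)%E.
Proof.
move=> Ux; apply: ereal_sup_ubound; exists x, x.
by split=> //; rewrite subrr normr0.
Qed.

Lemma diameter_le (R : realType) (U : set R) (l : R) :
  (forall x y, U x -> U y -> `|x - y| <= l) -> (diameter U <= l%:E)%E.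
Proof.
by move=> Ul; apply: ge_ereal_sup => _ [x [y [Ux Uy ->]]]; rewrite lee_fin Ul.
Qed.

Lemma diameter_pow_le (R : realType) (s l : R) (U : set R) : 0 <= s -> 0 <= l ->
  (diameter U <= l%:E)%E -> (diameter_pow s U <= (l `^ s)%:E)%E.
Proof.
move=> s0 l0 Ul; rewrite /diameter_pow; case: ifPn => [_|/set0P[x Ux]].
  by rewrite lee_fin powR_ge0.
rewrite -poweR_EFin; apply: (gt0_ler_poweR s0) => //;
  by rewrite in_itv /= ?leey ?andbT// ?lee_fin// (diameter_ge0 Ux).
Qed.

Lemma hausdorff_premeasure_ge0 (R : realType) (delta s : R) (E : set R) :
  (0 <= hausdorff_premeasure delta s E)%E.
Proof.
apply: le_ereal_inf_tmp => _ [U _ <-]; apply: nneseries_ge0 => k _ _.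
exact: diameter_pow_ge0.
Qed.

Lemma small_powR (R : realType) (delta t e : R) : 0 < delta -> 0 < t -> 0 < e ->
  exists2 l, 0 < l <= delta & l `^ t <= e.
Proof.
move=> d0 t0 e0; exists (Num.min delta (e `^ t^-1)).
  by rewrite lt_min d0 powR_gt0//= ge_min lexx.
have eE : e = (e `^ t^-1) `^ t.
  by rewrite -powRrM mulVf ?lt0r_neq0// powRr1// ltW.
rewrite [leRHS]eE.
apply: ge0_ler_powR; rewrite ?nnegrE ?powR_ge0 ?(ltW t0)//.
  by rewrite le_min ltW//= powR_ge0.
by rewrite ge_min lexx orbT.
Qed.

(** About [(B - A) / l] intervals of length [l <= 1] cover the set; their weight is at most
    [(B - A + 1) l^(s - 1)], which is small with [l] because [s > 1]. *)
Lemma hausdorff_premeasure_itv (R : realType) (A B delta s : R) (E : set R) :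
  A <= B -> 1 < s -> 0 < delta -> (forall x, E x -> A <= x <= B) ->
  hausdorff_premeasure delta s E = 0%E.
Proof.
move=> AB s1 d0 EAB; have s0 : 0 < s := lt_trans ltr01 s1.
apply/eqP; rewrite eq_le hausdorff_premeasure_ge0 andbT.
apply/lee_addgt0Pr => e e0; rewrite add0e.
have [|||l /andP[l0 ld] lt_e] :=
  @small_powR R (Num.min 1 delta) (s - 1) (e / (B - A + 1)).
- by rewrite lt_min ltr01.
- by rewrite subr_gt0.
- by rewrite divr_gt0// ltr_wpDl// subr_ge0.
have l1 : l <= 1 by rewrite (le_trans ld)// ge_min lexx.
have ldelta : l <= delta by rewrite (le_trans ld)// ge_min lexx orbT.
pose n := (Num.truncn ((B - A) / l)).+1.
pose U k : set R := if (k < n)%N then `[A + k%:R * l, A + k%:R * l + l]%classic else set0.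
have Ul k : (diameter (U k) <= l%:E)%E.
  apply: diameter_le => x y; rewrite /U; case: ifP => // _ /=.
  rewrite !in_itv /= => /andP[x1 x2] /andP[y1 y2].
  by rewrite ler_norml; apply/andP; split; lra.
apply: (@le_trans _ _ (\sum_(k <oo) diameter_pow s (U k))%E).
  apply: ereal_inf_lbound; exists U => //; split=> [x Ex|k]; last first.
    by rewrite (le_trans (Ul k))// lee_fin.
  have /andP[Ax xB] := EAB _ Ex.
  have xA0 : 0 <= (x - A) / l by rewrite divr_ge0 ?subr_ge0// ltW.
  exists (Num.truncn ((x - A) / l)) => //.
  rewrite /U ifT; last first.
    by rewrite ltnS le_truncn// ler_wpM2r ?invr_ge0 ?(ltW l0)// lerD2r.
  rewrite /= in_itv /=; apply/andP; split.
    by rewrite -lerBrDl -ler_pdivlMr// truncn_le.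
  have := truncnS_gt ((x - A) / l); rewrite -natr1 ltr_pdivrMr// => /ltW.
  by rewrite mulrDl mul1r; lra.
rewrite (@nneseries_split _ _ 0 n) => [|k _]; last exact: diameter_pow_ge0.
rewrite [X in (_ + X)%E]eseries0 => [|k le_nk _]; last first.
  have -> : U k = set0 by rewrite add0n in le_nk; rewrite /U ltnNge le_nk.
  by rewrite /diameter_pow eqxx.
rewrite adde0; apply: (@le_trans _ _ (\sum_(0 <= k < n) (l `^ s)%:E)%E).
  rewrite add0n; apply: lee_sum => k _.
  exact: diameter_pow_le (ltW s0) (ltW l0) (Ul k).
rewrite sumEFin lee_fin sumr_const_nat subn0 -mulr_natl.
have -> : l `^ s = l * l `^ (s - 1).
  have := @powRD R l 1 (s - 1); rewrite (gt_eqF l0) implybT powRr1 ?(ltW l0)//.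
  by rewrite addrCA subrr addr0 => ->.
rewrite mulrA.
apply: le_trans (_ : (B - A + 1) * l `^ (s - 1) <= _).
  rewrite ler_wpM2r ?powR_ge0// -natr1 mulrDl mul1r lerD//.
  by rewrite -ler_pdivlMr// truncn_le divr_ge0 ?subr_ge0// ltW.
by rewrite mulrC -ler_pdivlMr// ltr_wpDl// subr_ge0.
Qed.

Lemma hausdorff_dim_le1 (R : realType) (A B : R) (E : set R) :
  A <= B -> (forall x, E x -> A <= x <= B) -> (hausdorff_dim E <= 1)%E.
Proof.
move=> AB EAB; apply/lee_addgt0Pr => e e0; apply: ereal_inf_lbound.
exists (1 + e) => //=; split; first by rewrite addr_ge0// ltW.
rewrite /hausdorff_measure.
rewrite (_ : [set _ | _ in _] = [set 0%E]) ?ereal_sup1//.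
apply/seteqP; split=> [_ [d d0 <-]|_ ->].
  by apply: (hausdorff_premeasure_itv AB _ d0 EAB); rewrite ltrDl.
by exists 1 => //=; apply: (hausdorff_premeasure_itv AB _ _ EAB); rewrite ?ltrDl.
Qed.

(* A map [g] into [E] whose inverse is Hoelder of exponent [s] turns a cover of
   [E] of small [s]-weight into a cover of [[0, 1[] by short intervals. *)
Lemma hausdorff_measure_neq0 (R : realType) (E : set R) (g : R -> R) (s C : R) :
  0 <= s -> 0 < C -> (forall t, 0 <= t < 1 -> E (g t)) ->
  (forall t u, 0 <= t < 1 -> 0 <= u < 1 ->
     `|t - u| <= C * `|g t - g u| `^ s) ->
  hausdorff_measure s E <> 0%E.
Proof.
move=> s0 C0 Eg gC H0.
(* The threshold leaves total length at most 1/2 after the factor [2 C] lost below; the scale 1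
   makes the diameters finite. *)
have : (hausdorff_premeasure 1 s E < (4 * C)^-1%:E)%E.
  apply: (@le_lt_trans _ _ 0%E); last by rewrite lte_fin invr_gt0 mulr_gt0.
  by rewrite -H0; apply: ereal_sup_ubound; exists 1; rewrite //= ltr01.
case/ereal_inf_lt => _ [U [EU Ud] <-] Ulow.
have cov k : exists F : set R, [/\ measurable F,
    forall t, 0 <= t < 1 -> U k (g t) -> F t &
    (lebesgue_measure F <= (2 * C)%:E * diameter_pow s (U k))%E].
  (* If [U k] contains some [g t0], the Hoelder bound puts all its parameters within [C] times the
     [s]-th power of the diameter from [t0]; otherwise the empty set will do. *)
  have [[t0 [t01 Ut0]]|none] := pselect (exists t, 0 <= t < 1 /\ U k (g t)); last first.
    exists set0; split; [exact: measurable0|by move=> t t01 Ut; apply: none; exists t|].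
    by rewrite measure0 mule_ge0 ?diameter_pow_ge0// lee_fin mulr_ge0 ?ltW.
  have D0 := diameter_ge0 Ut0.
  have Dfin : diameter (U k) \is a fin_num.
    by rewrite ge0_fin_numE// (le_lt_trans (Ud k)) ?ltry.
  have DE : diameter_pow s (U k) = (fine (diameter (U k)) `^ s)%:E.
    rewrite /diameter_pow ifF; last by apply/negbTE/set0P; exists (g t0).
    by rewrite -{1}(fineK Dfin) poweR_EFin.
  set r := C * fine (diameter (U k)) `^ s.
  have r0 : 0 <= r by rewrite mulr_ge0 ?powR_ge0// ltW.
  exists `[t0 - r, t0 + r]%classic; split.
  - exact: measurable_itv.
  - move=> t t01' Ut; rewrite /= in_itv /= -ler_distl.
    apply: le_trans (gC _ _ t01' t01) _; rewrite ler_wpM2l ?(ltW C0)//.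
    apply: ge0_ler_powR; rewrite ?nnegrE ?fine_ge0//.
    by rewrite -lee_fin fineK//; apply: ereal_sup_ubound; exists (g t), (g t0).
  - rewrite lebesgue_measure_itv /= lte_fin DE -EFinM -mulrA -/r.
    case: ifP => _; last by rewrite lee_fin mulr_ge0.
    by rewrite -EFinB lee_fin; lra.
have [F Fk] := choice cov.
pose I : set R := `[0, 1[%classic.
have sub : I `<=` \bigcup_k F k.
  move=> t; rewrite /I /= in_itv /= => t01; have [k _ Uk] := EU _ (Eg _ t01).
  by exists k => //; have [_ + _] := Fk k; apply.
have : (lebesgue_measure I <= \sum_(k <oo) lebesgue_measure (F k))%E.
  apply: measure_sigma_subadditive => //; last exact: measurable_itv.
  by move=> k; have [] := Fk k.
rewrite /I lebesgue_measure_itv /= lte_fin ltr01 oppr0 adde0 leNgt => /negP; apply.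
apply: (@le_lt_trans _ _ ((2 * C)%:E * \sum_(k <oo) diameter_pow s (U k))%E).
  rewrite -nneseriesZl; last by move=> k _; exact: diameter_pow_ge0.
  by apply: lee_nneseries => // k _; have [] := Fk k.
apply: (@le_lt_trans _ _ ((2 * C)%:E * (4 * C)^-1%:E)%E).
  by apply: lee_wpmul2l; rewrite ?lee_fin ?mulr_ge0 ?ltW.
rewrite -EFinM lte_fin.
have -> : 2 * C * (4 * C)^-1 = 2^-1 by field; rewrite gt_eqF.
by rewrite invf_lt1// ltr1n.
Qed.

Lemma hausdorff_dim_ge1 (R : realType) (E : set R) :
  (forall s, 0 <= s < 1 -> hausdorff_measure s E <> 0%E) ->
  (1 <= hausdorff_dim E)%E.
Proof.
move=> E0; apply: le_ereal_inf_tmp => _ [s [s0 Es] <-]; rewrite lee_fin leNgt.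
by apply/negP => s1; apply: (E0 s) => //; rewrite s0.
Qed.

(** * Base-(M+1) digits written into quasi-greedy sequences *)

Definition frac_mul (R : realType) M (t : R) : R :=
  M.+1%:R * t - (Num.truncn (M.+1%:R * t))%:R.

Definition digit (R : realType) M (t : R) (i : nat) : 'I_M.+1 :=
  inord (Num.truncn (M.+1%:R * iter i (frac_mul M) t)).

Lemma frac_mul_itv (R : realType) M (t : R) : 0 <= t < 1 -> 0 <= frac_mul M t < 1.
Proof.
move=> /andP[t0 t1]; rewrite /frac_mul subr_ge0 truncn_le mulr_ge0//=.
by rewrite ltrBlDr addrC natr1 truncnS_gt.
Qed.

Lemma digit_close (R : realType) M (t u : R) n : 0 <= t < 1 -> 0 <= u < 1 ->
  (forall i, (i < n)%N -> digit M t i = digit M u i) ->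
  `|t - u| <= (M.+1%:R)^-1 ^+ n.
Proof.
elim: n t u => [|n IH] t u t01 u01 dig.
  by rewrite expr0 ler_norml; apply/andP; split; lra.
have b0 : (0 : R) < M.+1%:R by [].
have lt_b v : 0 <= v < 1 -> (Num.truncn (M.+1%:R * v : R) < M.+1)%N.
  by move=> /andP[v0 v1]; rewrite truncn_lt_nat ?mulr_ge0// gtr_pMr.
have eq0 : Num.truncn (M.+1%:R * t) = Num.truncn (M.+1%:R * u).
  have /(congr1 val) := dig 0%N isT.
  by rewrite /digit /= !inordK ?lt_b.
have -> : t - u = M.+1%:R^-1 * (frac_mul M t - frac_mul M u).
  by rewrite /frac_mul eq0; field; rewrite addrC natr1.
rewrite normrM exprS ger0_norm ?invr_ge0// ler_wpM2l ?invr_ge0//.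
apply: IH; [exact: frac_mul_itv|exact: frac_mul_itv|move=> i lt_in].
by have := dig i.+1 lt_in; rewrite /digit !iterSr.
Qed.

(* The prefix [M^(L+4)], then blocks [0 M w] of length [L + 2], where the words
   [w] of length [L] spell out [d]. *)
Definition block_seq M L (d : nat -> 'I_M.+1) : Sigma M := fun i =>
  let j := (i - (L + 4))%N in let r := (j %% (L + 2))%N in
  if (i < L + 4)%N || (r == 1)%N then ord_max
  else if r == 0%N then ord0
  else d (j %/ (L + 2) * L + (r - 2))%N.

Lemma block_seq_prefix M L (d : nat -> 'I_M.+1) i :
  (i < L + 4)%N -> block_seq L d i = ord_max.
Proof. by rewrite /block_seq => ->. Qed.

Lemma block_seqE M L (d : nat -> 'I_M.+1) q r : (r < L + 2)%N ->
  block_seq L d (L + 4 + (q * (L + 2) + r)) =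
  if r == 1%N then ord_max else if r == 0%N then ord0 else d (q * L + (r - 2))%N.
Proof.
move=> lt_r; rewrite /block_seq ltnNge leq_addr addKn modnMDl modn_small//=.
by rewrite divnMDl ?addn_gt0 ?orbT// divn_small// addn0.
Qed.

(** The markers 0 and M recur with period [L + 2] and cut every run, whatever the digits [d]. A
    window of length [L + 4] starting inside the prefix still reaches the first 0 because
    [p > 0]. *)
Lemma short_runs_block_seq M L (d : nat -> 'I_M.+1) : (0 < M)%N ->
  short_runs (L + 4) (L + 2) (block_seq L d).
Proof.
move=> M0; have ne0M : ord_max != ord0 :> 'I_M.+1 by rewrite -val_eqE /= -lt0n.
split=> [|i|p p0|p]; first by lia.
- exact: block_seq_prefix.
- case: (ltnP p (L + 4)) => [lt_p|le_p].
    exists (L + 4 - p)%N; first by lia.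
    rewrite (_ : p + _ = L + 4 + (0 * (L + 2) + 0))%N; last by lia.
    by rewrite (block_seqE d 0) /= 1?eq_sym//; lia.
  have eq_p := divn_eq (p - (L + 4)) (L + 2).
  have lt_r : ((p - (L + 4)) %% (L + 2) < L + 2)%N by rewrite ltn_mod; lia.
  set q := (_ %/ _)%N in eq_p; set r := (_ %% _)%N in eq_p lt_r.
  exists (L + 2 - r)%N; first by lia.
  rewrite (_ : p + _ = L + 4 + (q.+1 * (L + 2) + 0))%N; last by lia.
  by rewrite (block_seqE d q.+1) /= 1?eq_sym//; lia.
- case: (ltnP p (L + 4)) => [lt_p|le_p].
    by exists 0%N; rewrite ?addn0 ?block_seq_prefix//; lia.
  have eq_p := divn_eq (p - (L + 4)) (L + 2).
  have lt_r : ((p - (L + 4)) %% (L + 2) < L + 2)%N by rewrite ltn_mod; lia.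
  set q := (_ %/ _)%N in eq_p; set r := (_ %% _)%N in eq_p lt_r.
  case: (leqP r 1) => [le_r|gt_r].
    exists (1 - r)%N; first by lia.
    rewrite (_ : p + _ = L + 4 + (q * (L + 2) + 1))%N; last by lia.
    by rewrite (block_seqE d q)//; lia.
  exists (L + 3 - r)%N; first by lia.
  rewrite (_ : p + _ = L + 4 + (q.+1 * (L + 2) + 1))%N; last by lia.
  by rewrite (block_seqE d q.+1)//; lia.
Qed.

(** Agreement up to [n] covers all blocks ending by [n], and each reveals [L] digits: digit [i] sits
    in block [i / L] at place [i mod L + 2], after the two markers. *)
Lemma block_seq_digits M L (d e : nat -> 'I_M.+1) n :
  (forall i, (i < n)%N -> block_seq L d i = block_seq L e i) ->
  forall i, (i < (n - (L + 4)) %/ (L + 2) * L)%N -> d i = e i.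
Proof.
move=> agree i; set B := (_ %/ _)%N => lt_i.
have L0 : (0 < L)%N by move: lt_i; case: (L) => //; rewrite muln0.
have lt_r : (i %% L < L)%N by rewrite ltn_mod.
have lt_q : (i %/ L < B)%N by rewrite ltn_divLR.
have le_n : (B * (L + 2) <= n - (L + 4))%N by exact: leq_trunc_div.
have lt_pos : ((i %/ L) * (L + 2) + (i %% L + 2) < B * (L + 2))%N.
  apply: (@leq_trans ((i %/ L).+1 * (L + 2))); last by rewrite leq_pmul2r//; lia.
  by rewrite mulSn; lia.
have := agree (L + 4 + ((i %/ L) * (L + 2) + (i %% L + 2)))%N.
rewrite !block_seqE; [|lia|lia].
rewrite !ifF ?addnK -?divn_eq; [apply; lia|lia..].
Qed.

(** * From sequences to bases, and the Hoelder estimate *)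

Lemma mem_C_short_runs (R : realType) M N K (a : Sigma M) (x : R) : (0 < M)%N ->
  short_runs N K a -> 0 < x < 1 -> expansion a x = 1 ->
  C3' M x^-1 /\ C4' M x^-1.
Proof.
move=> M0 runs x01 a1; have /andP[x0 x1] := x01.
have qg : quasi_greedy x^-1 a.
  apply: quasi_greedy_expansion => // [n|n].
    exact: short_runs_shift_le runs.
  have [_ _ _ run0] := runs; have [i _ ai] := run0 n.
  by exists (n + i)%N; rewrite ?leq_addr.
have xM : x^-1 <= M.+1%:R.
  by rewrite invf_ple ?posrE// (root_ge x01 a1).
have V : calV M x^-1.
  split; first by rewrite invf_gt1// x1.
  by rewrite (alpha_eq qg); exact: short_runs_mem runs.
have bfVE : bfV (M := M) x^-1 = subshift_between a by rewrite /bfV (alpha_eq qg).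
split; split=> //; rewrite bfVE.
  exact: specification_short_runs runs.
exact: synchronised_short_runs runs.
Qed.

(* At the first difference, [expansion b x - expansion a x] is at least
   [x ^+ n.+1] times the tail of [b], because the tail of [a] is at most 1. *)
Lemma root_gap (R : realType) M N K (a b : Sigma M) (x y : R) n : (0 < M)%N ->
  short_runs N K a -> short_runs N K b ->
  0 < x <= 2 / 3 -> 0 < y <= 2 / 3 -> expansion a x = 1 -> expansion b y = 1 ->
  (forall i, (i < n)%N -> a i = b i) -> (a n < b n)%N ->
  (M.+1%:R)^-1 ^+ (n.+1 + K) <= 9 * M%:R * `|x^-1 - y^-1|.
Proof.
move=> M0 runs_a runs_b /andP[x0 xr] /andP[y0 yr] a1 b1 pfx lt_n.
have x1 : x < 1 by lra.
have x01 : 0 < x < 1 by rewrite x0.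
have x01' : 0 <= x < 1 by rewrite ltW.
have cx := root_ge x01 a1.
(* The root [x] is at least [(M + 1)^-1], and [b] has a nonzero digit among the [K] digits after
   position [n]. *)
have gap : (M.+1%:R)^-1 ^+ (n.+1 + K) <= expansion b x - expansion a x.
  apply: le_trans (_ : x ^+ (n.+1 + K) <= _).
    by rewrite lerXn2r ?nnegrE ?invr_ge0// ltW.
  rewrite (expansion_diff x01' pfx) exprD ler_wpM2l ?exprn_ge0 ?(ltW x0)//.
  have [_ _ _ run0] := runs_b; have [i iK bi] := run0 n.+1.
  have b_ge : x ^+ K <= expansion (iter n.+1 (@sigma M) b) x.
    apply: le_trans (_ : x ^+ i.+1 <= _).
      by apply: ler_wiXn2l; rewrite // ltW.
    by apply: expansion_digit_le; rewrite // iter_sigmaE.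
  have a_le := expansion_shift_le1 x01 a1 (fun m => short_runs_shift_le m runs_a) n.+1.
  have d1 : (1 : R) <= (b n)%:R - (a n)%:R by rewrite lerBrDr nat1r ler_nat.
  by lra.
have c0 : 0 < (M.+1%:R : R)^-1 ^+ (n.+1 + K) by rewrite exprn_gt0 ?invr_gt0.
have r1 : 2 / 3 < 1 :> R by lra.
(* The expansion of [b] at [x] exceeds 1, so by monotonicity its root [y] cannot lie above [x]. *)
have yx : y <= x.
  rewrite leNgt; apply/negP => /ltW xy.
  have /andP[+ _] := expansion_diff_le b (ltW x0) xy yr r1.
  by move: gap c0; rewrite a1 b1; lra.
apply: (le_trans gap); have := expansion_diff_le b (ltW y0) yx xr r1.
rewrite b1 a1 => /andP[_ /le_trans]; apply.
rewrite distrC.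
have -> : M%:R * (1 - 2 / 3) ^- 2 = 9 * M%:R :> R by field.
rewrite ler_wpM2l ?mulr_ge0// (le_trans _ (ler_norm _))//.
(* Passing to the bases does not shrink the distance, as [x y <= 1]. *)
have -> : y^-1 - x^-1 = (x - y) * (x * y)^-1.
  by field; rewrite !gt_eqF.
rewrite ler_peMr ?subr_ge0// invf_ge1 ?mulr_gt0// mulr_ile1 ?ltW//; lra.
Qed.

(** Let [c = 1 / (M + 1)]. Agreement in [B] blocks makes the parameters [c^(B L)]-close, whereas a
    difference by the end of the next block keeps the bases at least a constant times
    [c^(B (L + 2))] apart; [(L + 2) s <= L] turns this into the Hoelder bound. *)
Lemma hausdorff_measure_inv_roots_neq0 (R : realType) M (E : set R) (s : R) : (0 < M)%N ->
  (forall N K (a : Sigma M) (x : R), short_runs N K a -> 0 < x < 1 ->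
     expansion a x = 1 -> E x^-1) ->
  0 <= s < 1 -> hausdorff_measure s E <> 0%E.
Proof.
move=> M0 memE /andP[s0 s1].
have [L L0 Ls] : exists2 L : nat, (0 < L)%N & (L + 2)%:R * s <= L%:R.
  exists (Num.truncn (2 * s / (1 - s))).+1 => //.
  have /ltW := truncnS_gt (2 * s / (1 - s)).
  by rewrite ler_pdivrMr ?subr_gt0// natrD; lra.
have L2 : (0 < L + 2)%N by rewrite addn2.
pose a t := block_seq L (@digit R M t).
have runs t : short_runs (L + 4) (L + 2) (a t) by exact: short_runs_block_seq.
have roots t : exists x : R, 0 < x <= 2 / 3 /\ expansion (a t) x = 1.
  have ne0M : ord_max != ord0 :> 'I_M.+1 by rewrite -val_eqE /= -lt0n.
  have [||x xr x1] := @expansion_root R M (a t); last by exists x.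
    by rewrite /a block_seq_prefix//; lia.
  by rewrite /a block_seq_prefix//; lia.
have [x xP] := choice roots.
pose c : R := M.+1%:R^-1.
have c0 : 0 < c by rewrite invr_gt0.
have c1 : c < 1 by rewrite invf_lt1// ltr1n.
(* The exponent adds up the prefix [L + 4], the block of length [L + 2] where the sequences part,
   and the [L + 2] digits among which the tail has a nonzero one; [9 M] comes from [root_gap]. *)
pose kappa : R := c ^+ (3 * L + 8) / (9 * M%:R).
have k0 : 0 < kappa by rewrite divr_gt0 ?exprn_gt0 ?mulr_gt0// ltr0n.
have ks0 : 0 < kappa `^ s by exact: powR_gt0.
apply: (@hausdorff_measure_neq0 _ _ (fun t => (x t)^-1) s (kappa `^ s)^-1) => //.
- by rewrite invr_gt0.
- move=> t _; have [/andP[x0 xr] x1] := xP t.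
  by apply: memE (runs t) _ x1; rewrite x0; lra.
move=> t u t01 u01.
wlog le_tu : t u t01 u01 / (a t <= a u)%O => [H|].
  have [|] := orP (le_total (a t) (a u)); first exact: H.
  by rewrite distrC [`|_ - (x u)^-1|]distrC; exact: H.
(* Equal sequences make [t] and [u] share all digits, so their distance is at most every power of
   [c], hence 0. *)
case/lex_le_eqVlt : le_tu => [eq_a|[n pfx lt_n]].
  have le_c n : `|t - u| <= geometric 1 c n.
    rewrite /geometric /= mul1r; apply: digit_close => // i _.
    apply: (@block_seq_digits _ L _ _ (L + 4 + i.+1 * (L + 2))) => [j _|].
      by rewrite -/(a t) eq_a.
    rewrite addKn mulnK//; exact: leq_pmulr.
  apply: (@le_trans _ _ 0); last by rewrite mulr_ge0 ?powR_ge0// invr_ge0 ltW.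
  have := @cvg_geometric R 1 c; rewrite ger0_norm ?(ltW c0)// => /(_ c1) cvg0.
  rewrite -(cvg_lim (@Rhausdorff R) cvg0); apply: limr_ge; first exact: (cvgP _ cvg0).
  exact: nearW.
pose B := ((n - (L + 4)) %/ (L + 2))%N.
have tu_le : `|t - u| <= c ^+ (B * L).
  by apply: digit_close => // i; exact: block_seq_digits pfx _.
have lt_nB : (n < L + 4 + B.+1 * (L + 2))%N.
  have := ltn_ceil (n - (L + 4)) L2; rewrite -/B.
  by case: (ltnP n (L + 4)) => [lt_n4 _|le_4n]; [exact: ltn_addr|rewrite ltn_subLR].
have [xt xt1] := xP t; have [xu xu1] := xP u.
have gap := root_gap M0 (runs t) (runs u) xt xu xt1 xu1 pfx lt_n.
set delta := `|_ - (x u)^-1| in gap *.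
have delta_ge : c ^+ (B * (L + 2)) * kappa <= delta.
  rewrite /kappa mulrA ler_pdivrMr ?mulr_gt0 ?ltr0n// [leRHS]mulrC -exprD.
  apply: le_trans gap; apply: ler_wiXn2l; [exact: ltW..|].
  by move: lt_nB; rewrite mulSn; move: (B * _)%N; clear; lia.
rewrite mulrC ler_pdivlMr//.
apply: (@le_trans _ _ ((c ^+ (B * (L + 2)) * kappa) `^ s)); last first.
  apply: ge0_ler_powR; rewrite ?nnegrE ?normr_ge0//.
  by rewrite mulr_ge0 ?exprn_ge0 ?(ltW c0) ?(ltW k0).
rewrite powRM ?exprn_ge0 ?(ltW c0) ?(ltW k0)// ler_wpM2r ?(ltW ks0)//.
apply: (le_trans tu_le); rewrite -!powR_mulrn ?(ltW c0)// -powRrM.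
apply: ger_powR; first by rewrite c0 ltW.
by rewrite !natrM -mulrA ler_wpM2l.
Qed.

Theorem proposition6p2 (R : realType) (M : nat) (hM : (0 < M)%N) :
  hausdorff_dim (@C3' R M) = 1%E /\ hausdorff_dim (@C4' R M) = 1%E.
Proof.
have le_1M : (1 : R) <= M.+1%:R by rewrite ler1n.
(* Both sets lie in [[1, M + 1]], which bounds the dimension by 1, and both contain the inverse
   roots of all sequences with short runs, so one argument serves twice. *)
have dim1 (E : set R) : (forall q, E q -> 1 < q <= M.+1%:R) ->
    (forall N K (a : Sigma M) (x : R), short_runs N K a -> 0 < x < 1 ->
       expansion a x = 1 -> E x^-1) -> hausdorff_dim E = 1%E.
  move=> EM memE; apply/le_anti; rewrite (hausdorff_dim_le1 le_1M)/= => [|q Eq].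
    apply: hausdorff_dim_ge1 => s s01.
    exact: (hausdorff_measure_inv_roots_neq0 hM memE s01).
  by have /andP[/ltW -> ->] := EM _ Eq.
split; apply: dim1 => [q [[]]//|N K a x runs x01 a1].
  by have [] := mem_C_short_runs hM runs x01 a1.
by have [] := mem_C_short_runs hM runs x01 a1.
Qed.
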